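(* Let $V$ be a finite-dimensional real vector space, let $M$ be a smooth manifold, let $\phi:M\to V$ be a diffeomorphism, and let $(M,\star)$ be the associated log-Euclidean Lie group. A Riemannian metric $g$ on $M$ is bi-invariant (invariant under all left and right translations of $(M,\star)$) if and only if there exists an inner product $\langle\cdot,\cdot\rangle$ on $V$ such that $g=\phi^*\langle\cdot,\cdot\rangle$, i.e. $g_p(\delta,\xi)=\langle \mathrm d_p\phi(\delta),\mathrm d_p\phi(\xi)\rangle$ for all $p\in M$ and all $\delta,\xi\in T_pM$.
   Context: Given a diffeomorphism $\phi:M\to V$ from a smooth manifold onto a finite-dimensional real vector space, the log-Euclidean Lie group $\phi:(M,\star)\to V$ is $M$ equipped with the group law $u\star v=\phi^{-1}(\phi(u)+\phi(v))$, with identity $e_M=\phi^{-1}(0)$ and inverse $u_\star^{-1}=\phi^{-1}(-\phi(u))$; it is a commutative Lie group. Tangent spaces of $V$ are identified with $V$, so an inner product on $V$ is regarded as a constant Riemannian metric on $V$. *)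

(* Defs.v *)
From HB Require Import structures.
From mathcomp Require Import all_boot all_order all_algebra.
From mathcomp Require Import all_classical all_reals all_analysis.

Set Implicit Arguments.
Unset Strict Implicit.
Unset Printing Implicit Defensive.

Import Order.TTheory GRing.Theory Num.Theory.
Import numFieldNormedType.Exports.

Local Open Scope classical_set_scope.
Local Open Scope ring_scope.

(* [Ck_on k U f] is meant for open [U]: [f] is differentiable on [U] and, for
   every direction [v], [x |-> Df(x) v] is [C^(k-1)] on [U]. Since the source
   ['rV[R]_n] is finite-dimensional, this is the usual notion of [C^k]. *)
Fixpoint Ck_on (R : realType) (n : nat) (W : normedModType R) (k : nat)
    (U : set 'rV[R]_n) (f : 'rV[R]_n -> W) : Prop :=
  match k with
  | 0 => forall x, U x -> {for x, continuous f}
  | j.+1 => (forall x, U x -> differentiable f x) /\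
            (forall v, Ck_on j U (fun x => 'd f x v))
  end.

Definition smooth_on (R : realType) (n : nat) (W : normedModType R)
    (U : set 'rV[R]_n) (f : 'rV[R]_n -> W) : Prop :=
  forall k, Ck_on k U f.

(* Charts are represented by total functions; only the values of [chart_map] on
   [chart_dom] and of [chart_inv] on its image are relevant. *)
Record chart (R : realType) (n : nat) (M : topologicalType) := Chart {
  chart_dom : set M;
  chart_map :> M -> 'rV[R]_n;
  chart_inv : 'rV[R]_n -> M;
  chart_dom_open : open chart_dom;
  chart_cod_open : open (chart_map @` chart_dom);
  chart_mapK : forall p, chart_dom p -> chart_inv (chart_map p) = p;
  chart_map_continuous : forall p, chart_dom p -> {for p, continuous chart_map};
  chart_inv_continuous :
    forall x, (chart_map @` chart_dom) x -> {for x, continuous chart_inv} }.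

(* The atlas need not be maximal: it determines the smooth structure. *)
HB.mixin Record isSmoothManifold (R : realType) (n : nat) M
    of Topological M := {
  manifold_hausdorff : hausdorff_space M;
  manifold_second_countable : @second_countable M;
  atlas : set (chart R n M);
  atlas_cover : forall p : M, exists2 c, atlas c & chart_dom c p;
  atlas_compat : forall c d, atlas c -> atlas d ->
    smooth_on (c @` (chart_dom c `&` chart_dom d)) (d \o chart_inv c) }.

#[short(type="smoothManifoldType")]
HB.structure Definition SmoothManifold (R : realType) (n : nat) :=
  {M of isSmoothManifold R n M & Topological M}.

Section LocalDifferential.
Context {R : realType} {V W : normedModType R}.

Lemma near_eq_diff (f g : V -> W) (x : V) :
  (\forall y \near x, f y = g y) -> differentiable f x ->
  differentiable g x /\ ('d g x = 'd f x :> (V -> W)).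
Proof.
move=> fg df; have [dfc dfE] := (diff_locallyP x f).1 df.
have gE : g \o shift x = cst (g x) + 'd f x +o_ 0 id.
  apply/eqaddoP => e e0.
  have fg0 : \forall y \near (0 : V), f (y + x) = g (y + x).
    have xc : (y + x) @[y --> (0 : V)] --> (0 + x).
      by apply: cvgD; [exact: cvg_id | exact: cvg_cst].
    by apply: (xc (fun y => f y = g y)); rewrite add0r.
  have fgx : f x = g x by exact: nbhs_singleton fg.
  have /eqaddoP/(_ e e0) := dfE.
  apply: filterS2 fg0 => y fgy /=.
  by rewrite /GRing.add /GRing.opp/= /shift /= fgy fgx.
have dgE : 'd g x = 'd f x :> (V -> W) by apply: diff_unique.
split; last exact: dgE.
by apply/diff_locallyP; rewrite dgE; split; [exact: dfc|exact: gE].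
Qed.

End LocalDifferential.

Section Transition.
Context {R : realType} {n : nat} {M : smoothManifoldType R n}.
Implicit Types c d : chart R n M.

Lemma near_chart_inv c (p : M) (A : set M) : chart_dom c p -> nbhs p A ->
  \forall x \near c p, A (chart_inv c x).
Proof.
move=> cp Ap; apply: (chart_inv_continuous (c := c)); first by exists p.
by rewrite chart_mapK.
Qed.

Lemma transition_differentiable c d (p : M) :
  atlas c -> atlas d -> chart_dom c p -> chart_dom d p ->
  differentiable (d \o chart_inv c) (c p).
Proof.
move=> ac ad cp dp; have [+ _] := atlas_compat c d ac ad 1%N.
by apply; exists p.
Qed.

End Transition.

Section Tangent.
Context {R : realType} {n : nat} {M : smoothManifoldType R n}.

Record chart_at (p : M) := ChartAt {
  chart_of :> chart R n M;
  chart_at_atlas : atlas chart_of;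
  chart_at_dom : chart_dom chart_of p }.

Lemma chart_at_ex (p : M) : exists _ : chart_at p, True.
Proof. by have [c ac cp] := atlas_cover p; exists (ChartAt ac cp). Qed.

Definition some_chart (p : M) : chart_at p := projT1 (cid (chart_at_ex p)).

(* A tangent vector at [p] is a family of coordinate vectors, one for each chart
   around [p], which transforms by the differentials of the changes of charts;
   equivalently, a class of pairs (chart, coordinate vector). *)
Definition tangent_compat (p : M) : pred (chart_at p -> 'rV[R]_n) :=
  fun v => `[< forall c d : chart_at p,
    v d = 'd (d \o chart_inv c : 'rV[R]_n -> 'rV[R]_n) (c p) (v c) >].

Lemma tangent_submod_closed (p : M) : submod_closed (@tangent_compat p).
Proof.
split=> [|a u v /asboolP hu /asboolP hv]; apply/asboolP => c d.
  by rewrite linear0.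
rewrite [LHS]/(_ + _)/= [in LHS](_ : (a *: u) d = a *: u d)//.
by rewrite (hu c d) (hv c d) linearP.
Qed.

HB.instance Definition _ (p : M) :=
  GRing.isSubmodClosed.Build R (chart_at p -> 'rV[R]_n) (@tangent_compat p)
    (GRing.submod_closed_semi (@tangent_submod_closed p)).

Record tangent (p : M) := Tangent {
  coordinates :> chart_at p -> 'rV[R]_n;
  coordinatesP : coordinates \in @tangent_compat p }.

HB.instance Definition _ (p : M) := [isSub for @coordinates p].
HB.instance Definition _ (p : M) := [Choice of tangent p by <:].
HB.instance Definition _ (p : M) := [SubChoice_isSubLmodule of tangent p by <:].

Lemma tangent_of_subproof (p : M) (c : chart_at p) (a : 'rV[R]_n) :
  (fun d : chart_at p => 'd (d \o chart_inv c : 'rV[R]_n -> 'rV[R]_n) (c p) a)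
    \in @tangent_compat p.
Proof.
apply/asboolP => d e.
have dcp : (d \o chart_inv c) (c p) = d p.
  by rewrite /= chart_mapK//; exact: chart_at_dom.
have dc : differentiable (d \o chart_inv c) (c p).
  by case: c d {e dcp} => [c ac cp] [d ad dp]; exact: transition_differentiable.
have ed : differentiable (e \o chart_inv d) ((d \o chart_inv c) (c p)).
  rewrite dcp; case: e d {dc dcp} => [e ae ep] [d ad dp].
  exact: transition_differentiable.
have edc := differentiable_comp dc ed.
have near_ec : \forall x \near c p,
    ((e \o chart_inv d) \o (d \o chart_inv c)) x = (e \o chart_inv c) x.
  have dp : nbhs p (chart_dom d).
    by apply: open_nbhs_nbhs; split; [exact: chart_dom_open|case: (d)].
  have := near_chart_inv (chart_at_dom c) dp.
  by apply: filterS => x dx /=; rewrite chart_mapK.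
have [_ ec] := @near_eq_diff _ _ _ ((e \o chart_inv d) \o (d \o chart_inv c))
  (e \o chart_inv c) (c p) near_ec edc.
move: (etrans ec (diff_comp dc ed)); rewrite dcp => eE.
exact: (congr1 (fun h => h a) eE).
Qed.

(* The tangent vector at [p] whose coordinates in the chart [c] are [a]. *)
Definition tangent_of (p : M) (c : chart_at p) (a : 'rV[R]_n) : tangent p :=
  Tangent (tangent_of_subproof c a).

(* The coordinate vector field of [c] in the direction [a], extended by zero
   outside of the domain of [c]. *)
Definition coord_field (c : chart R n M) (a : 'rV[R]_n) (p : M) : tangent p :=
  match pselect (atlas c /\ chart_dom c p) with
  | left (conj ac cp) => tangent_of (ChartAt ac cp) a
  | right _ => 0
  end.

(* [{dot U for idfun}] is the type of symmetric positive definite bilinear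
   forms on [U]. *)
Record riemannian_metric := RiemannianMetric {
  metric :> forall p : M, {dot (tangent p) for idfun};
  metric_smooth : forall (c : chart R n M) (a b : 'rV[R]_n), atlas c ->
    smooth_on (c @` chart_dom c) (fun x => let p := chart_inv c x in
      metric p (coord_field c a p) (coord_field c b p) : R^o) }.

End Tangent.
Arguments tangent {R n M} p.
Arguments riemannian_metric {R n} M.

Definition smooth_map (R : realType) (m n : nat) (M : smoothManifoldType R m)
    (N : smoothManifoldType R n) (F : M -> N) : Prop :=
  continuous F /\
  forall (c : chart R m M) (d : chart R n N), atlas c -> atlas d ->
    smooth_on (c @` (chart_dom c `&` F @^-1` chart_dom d))
              (d \o F \o chart_inv c).

Record diffeomorphism (R : realType) (m n : nat) (M : smoothManifoldType R m)
    (N : smoothManifoldType R n) := Diffeomorphism {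
  diffeo :> M -> N;
  diffeo_inv : N -> M;
  diffeoK : cancel diffeo diffeo_inv;
  diffeo_invK : cancel diffeo_inv diffeo;
  diffeo_smooth : smooth_map diffeo;
  diffeo_inv_smooth : smooth_map diffeo_inv }.

(* The differential is computed in arbitrarily chosen charts; for [F] smooth,
   it does not depend on them, see [differentialE]. *)
Definition differential (R : realType) (m n : nat) (M : smoothManifoldType R m)
    (N : smoothManifoldType R n) (F : M -> N) (p : M) (u : tangent p) :
    tangent (F p) :=
  let c := some_chart p in let d := some_chart (F p) in
  tangent_of d ('d (d \o F \o chart_inv c : 'rV[R]_m -> 'rV[R]_n) (c p) (u c)).

Lemma differentialE (R : realType) (m n : nat) (M : smoothManifoldType R m)
    (N : smoothManifoldType R n) (F : M -> N) (p : M) (u : tangent p)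
    (c : chart_at p) (d : chart_at (F p)) : smooth_map F ->
  differential F u d =
    'd (d \o F \o chart_inv c : 'rV[R]_m -> 'rV[R]_n) (c p) (u c).
Proof.
move=> [cF sF]; rewrite /differential /=.
move: (some_chart p) (some_chart (F p)) => c0 d0.
have dF (a : chart_at p) (b : chart_at (F p)) :
    differentiable (b \o F \o chart_inv a : 'rV[R]_m -> 'rV[R]_n) (a p).
  case: a b => [a aa ap] [b ab bFp]; have [+ _] := sF a b aa ab 1%N.
  by apply; exists p.
have dd : differentiable (d \o chart_inv d0) (d0 (F p)).
  case: d d0 => [d ad dp] [d0 ad0 dp0]; exact: transition_differentiable.
have cc : differentiable (c0 \o chart_inv c) (c p).
  case: c c0 => [c ac cp] [c0 ac0 cp0]; exact: transition_differentiable.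
have uE : u c0 = 'd (c0 \o chart_inv c : 'rV[R]_m -> 'rV[R]_m) (c p) (u c).
  by have /asboolP := coordinatesP u; exact.
rewrite uE.
set f1 := (c0 \o chart_inv c : 'rV[R]_m -> 'rV[R]_m) in uE cc *.
set f2 := (d0 \o F \o chart_inv c0 : 'rV[R]_m -> 'rV[R]_n).
set f3 := (d \o chart_inv d0 : 'rV[R]_n -> 'rV[R]_n) in dd *.
have f1E : f1 (c p) = c0 p.
  by rewrite /f1/= chart_mapK//; case: (c).
have f2E : f2 (c0 p) = d0 (F p).
  by rewrite /f2/= chart_mapK//; case: (c0).
have d2 : differentiable f2 (f1 (c p)) by rewrite f1E; exact: dF.
have d21 := differentiable_comp cc d2.
have d3 : differentiable f3 ((f2 \o f1) (c p)) by rewrite /comp f1E f2E.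
have d321 := differentiable_comp d21 d3.
have near_e : \forall x \near c p,
    (f3 \o (f2 \o f1)) x = (d \o F \o chart_inv c : 'rV[R]_m -> 'rV[R]_n) x.
  have c0p : nbhs p (chart_dom c0).
    by apply: open_nbhs_nbhs; split; [exact: chart_dom_open|case: (c0)].
  have d0p : nbhs p (F @^-1` chart_dom d0).
    have d0F : nbhs (F p) (chart_dom d0).
      by apply: open_nbhs_nbhs; split; [exact: chart_dom_open|case: (d0)].
    exact: (cF p _ d0F).
  have c0d0p : nbhs p (chart_dom c0 `&` F @^-1` chart_dom d0) by exact: filterI.
  have := near_chart_inv (chart_at_dom c) c0d0p.
  apply: filterS => x [c0x d0x]; rewrite /f1 /f2 /f3 /comp.
  by rewrite (chart_mapK c0x) (chart_mapK d0x).
have [_ e] := near_eq_diff near_e d321.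
have e3 : 'd f3 ((f2 \o f1) (c p)) = 'd f3 (d0 (F p)).
  by rewrite /comp f1E f2E.
have e2 : 'd f2 (f1 (c p)) = 'd f2 (c0 p) by rewrite f1E.
move: (etrans e (diff_comp d21 d3)) (diff_comp cc d2).
rewrite e3 e2 => E1 E2.
have E1u := congr1 (fun h => h (u c)) E1; have E2u := congr1 (fun h => h (u c)) E2.
exact/esym/(etrans E1u)/(congr1 ('d f3 (d0 (F p))))/E2u.
Qed.

(* Invariance of [g] under the left and right translations of the law [op]:
   [L_u^* g = g] and [R_u^* g = g] for all [u]. *)
Definition bi_invariant (R : realType) (n : nat) (M : smoothManifoldType R n)
    (op : M -> M -> M) (g : riemannian_metric M) : Prop :=
  (forall (u p : M) (x y : tangent p),
     g (op u p) (differential (op u) x) (differential (op u) y) = g p x y) /\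
  (forall (u p : M) (x y : tangent p),
     g (op p u) (differential (op^~ u) x) (differential (op^~ u) y) = g p x y).

Lemma Ck_on_cst (R : realType) (n : nat) (W : normedModType R) (a : W)
    (U : set 'rV[R]_n) k : Ck_on k U (cst a).
Proof.
elim: k a => [|k IHk] a /=; first by move=> x _; exact: cst_continuous.
split=> [x _|v]; first exact: differentiable_cst.
rewrite (_ : (fun _ => _) = cst 0); first exact: IHk.
by apply/funext => x; rewrite diff_cst.
Qed.

Lemma smooth_on_id (R : realType) (n : nat) (U : set 'rV[R]_n) :
  smooth_on U (fun x : 'rV[R]_n => x).
Proof.
case=> [|k] /=; first by move=> x _; exact: cvg_id.
split=> [x _|v]; first exact: ex_diff.
rewrite (_ : (fun _ => _) = cst v); first exact: Ck_on_cst.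
by apply/funext => x; rewrite (@diff_val _ _ _ _ _ id id).
Qed.

Lemma rV_second_countable (R : realType) n : @second_countable 'rV[R]_n.
Proof.
exists (range (fun qk : 'rV[rat]_n * nat =>
    ball (map_mx ratr qk.1 : 'rV[R]_n) qk.2.+1%:R^-1)).
  apply: (card_le_trans (card_image_le _ _)); exact: countableP.
split=> [_ [[q k] _ <-]|x A /nbhs_ballP[e /= e0 xA]].
  exact: ball_open.
have [k ke] : exists k : nat, k.+1%:R^-1 < e / 2.
  have [|k] := @ltr_add_invr R 0 (e / 2); first by rewrite divr_gt0.
  by rewrite add0r => ?; exists k.
have k0 : (0 : R) < k.+1%:R^-1 by rewrite invr_gt0.
have /choice[q qP] : forall i : 'I_n, exists q : rat,
    x 0 i - k.+1%:R^-1 < ratr q < x 0 i + k.+1%:R^-1.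
  move=> i; have /rat_in_itvoo[q /itvP qr] :
      x 0 i - k.+1%:R^-1 < x 0 i + k.+1%:R^-1.
    by rewrite ltrBlDr -addrA ltrDl addr_gt0.
  by exists q; rewrite !qr.
have xq : ball (map_mx ratr (\row_i q i) : 'rV[R]_n) k.+1%:R^-1 x.
  split=> // i j; rewrite !mxE ord1 /ball/= ltr_distl; exact: qP.
exists (ball (map_mx ratr (\row_i q i) : 'rV[R]_n) k.+1%:R^-1).
  by split=> //; exists (\row_i q i, k).
apply: subset_trans xA => y qy; rewrite (splitr e).
have le2 := ltW ke.
exact: ball_triangle (le_ball le2 (ball_sym xq)) (le_ball le2 qy).
Qed.

(* A finite-dimensional real vector space, with its canonical topology and
   smooth structure: the ones for which the linear coordinates in some, hence
   any, basis form a global chart. *)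
Section VectorSpace.
Context {R : realType} {V : vectType R}.

Definition vcoord : V -> 'rV[R]_(\dim {:V}) := passmx.rVof (vbasis {:V}).
Definition vcoord_inv : 'rV[R]_(\dim {:V}) -> V := passmx.vecof (vbasis {:V}).

Lemma vcoordK : cancel vcoord vcoord_inv.
Proof. exact: passmx.rVofK (vbasisP _). Qed.

Lemma vcoord_invK : cancel vcoord_inv vcoord.
Proof. exact: passmx.vecofK (vbasisP _). Qed.

Definition vect_manifold : Type := initial_topology vcoord.
HB.instance Definition _ := Topological.on vect_manifold.

Local Notation VM := vect_manifold.

Lemma vcoord_continuous : continuous (vcoord : VM -> 'rV[R]_(\dim {:V})).
Proof. exact: initial_continuous. Qed.

Lemma vcoord_inv_continuous :
  continuous (vcoord_inv : 'rV[R]_(\dim {:V}) -> VM).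
Proof.
apply/continuousP => _ [A oA <-].
rewrite -comp_preimage (_ : _ \o _ = id) ?preimage_id//.
by apply/funext => x /=; rewrite vcoord_invK.
Qed.

Lemma vect_hausdorff : hausdorff_space VM.
Proof.
move=> p q pq; apply: (can_inj vcoordK); apply: norm_hausdorff => A B Ap Bq.
have [v [Av Bv]] := pq _ _ (vcoord_continuous Ap) (vcoord_continuous Bq).
by exists (vcoord v).
Qed.

Lemma vect_second_countable : @second_countable VM.
Proof.
have [B cB [oB bB]] := @rV_second_countable R (\dim {:V}).
exists (preimage (vcoord : VM -> _) @` B).
  exact: (card_le_trans (card_image_le _ _)).
split=> [_ [A BA <-]|p A].
  by have /continuousP := vcoord_continuous; apply; exact: oB.
have pE : p = vcoord_inv (vcoord p) :> VM by rewrite vcoordK.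
rewrite {1}pE => /vcoord_inv_continuous/bB[C [BC Cp] CA].
exists (vcoord @^-1` C); first by split=> //; exists C.
by move=> v /CA/=; rewrite vcoordK.
Qed.

Lemma vect_chart_cod_open :
  open ((vcoord : VM -> 'rV[R]_(\dim {:V})) @` [set: VM]).
Proof.
rewrite (_ : _ @` _ = setT); first exact: openT.
by rewrite -subTset => x _; exists (vcoord_inv x) => //; rewrite vcoord_invK.
Qed.

Definition vect_chart : chart R (\dim {:V}) VM :=
  Chart openT vect_chart_cod_open (fun p _ => vcoordK p)
    (fun p _ => @vcoord_continuous p) (fun x _ => @vcoord_inv_continuous x).

Lemma vect_atlas_cover (p : VM) :
  exists2 c, [set vect_chart] c & chart_dom c p.
Proof. by exists vect_chart. Qed.

Lemma vect_atlas_compat (c d : chart R (\dim {:V}) VM) :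
  [set vect_chart] c -> [set vect_chart] d ->
  smooth_on (c @` (chart_dom c `&` chart_dom d)) (d \o chart_inv c).
Proof.
move=> -> ->; rewrite (_ : _ \o _ = id); first exact: smooth_on_id.
by apply/funext => x /=; rewrite vcoord_invK.
Qed.

HB.instance Definition _ := isSmoothManifold.Build R (\dim {:V}) VM
  vect_hausdorff vect_second_countable vect_atlas_cover vect_atlas_compat.

Definition vect_chart_at (p : VM) : chart_at p :=
  @ChartAt R (\dim {:V}) VM p vect_chart erefl I.

(* The identification of the tangent spaces of [V] with [V]. *)
Definition tangent_vect (p : VM) (u : tangent p) : V :=
  vcoord_inv (u (vect_chart_at p)).

End VectorSpace.
Arguments vect_manifold {R} V.

Definition log_euclidean_mul (R : realType) (V : vectType R) (n : nat)
    (M : smoothManifoldType R n) (phi : diffeomorphism M (vect_manifold V))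
    (u v : M) : M :=
  diffeo_inv phi ((phi u : V) + (phi v : V)).

Definition vect_differential (R : realType) (V : vectType R) (n : nat)
    (M : smoothManifoldType R n) (phi : M -> vect_manifold V) (p : M)
    (u : tangent p) : V :=
  tangent_vect (differential phi u).

(* Main.v *)
(* In the coordinate phi the translations of the log-Euclidean group are the
   translations of V, so d phi is unchanged under them: every pullback of an
   inner product is bi-invariant, and a bi-invariant metric is determined by its
   value at the identity e = phi^-1(0), which is transported to V by the
   isomorphism d(phi^-1)_0 : V -> T_e M. *)
Require Import Defs.
From HB Require Import structures.
From mathcomp Require Import all_boot all_order all_algebra.
From mathcomp Require Import all_classical all_reals all_analysis.

Set Implicit Arguments.
Unset Strict Implicit.
Unset Printing Implicit Defensive.

Import Order.TTheory GRing.Theory Num.Theory.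
Import numFieldNormedType.Exports.

Local Open Scope classical_set_scope.
Local Open Scope ring_scope.

(** * Pulling back an inner product along an injective linear map *)

Section PullbackDot.
Context {R : realType} {U W : lmodType R} (f : {dot W for idfun})
  (L : {linear U -> W}) (injL : injective L).

Definition pullback_dot (u v : U) : R := f (L u) (L v).

Let pullback_dot_bilinear : bilinear_for *%R (idfun \; *%R) pullback_dot.
Proof.
split=> [v a u u'|u a v v']; rewrite /pullback_dot linearP.
  by rewrite linearPl.
by rewrite linearPr.
Qed.

HB.instance Definition _ := bilinear_isBilinear.Build R U U R *%R
  (idfun \; *%R) pullback_dot pullback_dot_bilinear.

Let pullback_dot_herm (u v : U) :
  pullback_dot u v = (-1) ^+ false * idfun (pullback_dot v u).
Proof. exact: hermitian_subproof. Qed.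

HB.instance Definition _ := isHermitianSesquilinear.Build R U false idfun
  pullback_dot pullback_dot_herm.

Let pullback_dot_gt0 (u : U) : u != 0 -> 0 < pullback_dot u u.
Proof.
by move=> u0; apply: neq0_dnorm_gt0; rewrite -(raddf0 L) (inj_eq injL).
Qed.

HB.instance Definition _ := isDotProduct.Build R U pullback_dot
  pullback_dot_gt0.

(** Hides the construction: users get a packaged form known only by its values. *)
Lemma pullback_dot_ex :
  exists h : {dot U for idfun}, forall u v, h u v = f (L u) (L v).
Proof. by exists pullback_dot. Qed.

End PullbackDot.

(** * Tangent vectors read in a single chart *)

Section TangentCoordinates.
Context {R : realType} {n : nat} {M : smoothManifoldType R n}.

Lemma chart_near_dom (c : chart R n M) (p : M) :
  chart_dom c p -> \forall q \near p, chart_dom c q.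
Proof.
by move=> cp; apply: open_nbhs_nbhs; split=> //; exact: chart_dom_open.
Qed.

(** The composite is the identity on the image of the chart, which is open, and a differential
    depends only on the germ. *)
Lemma diff_chart_id (c : chart R n M) (p : M) : chart_dom c p ->
  differentiable (c \o chart_inv c) (c p) /\
  'd (c \o chart_inv c) (c p) = id :> ('rV[R]_n -> 'rV[R]_n).
Proof.
move=> cp.
have near_id : \forall x \near c p, id x = (c \o chart_inv c) x.
  have : \forall x \near c p, (c @` chart_dom c) x.
    by apply: open_nbhs_nbhs; split; [exact: chart_cod_open|exists p].
  by apply: filterS => _ [q cq <-] /=; rewrite chart_mapK.
have [dcc ->] := near_eq_diff near_id ex_diff.
by split=> //; rewrite (@diff_val _ _ _ _ _ id id).
Qed.

Lemma tangent_ofE (p : M) (c : chart_at p) (a : 'rV[R]_n) :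
  tangent_of c a c = a.
Proof. by rewrite /= (diff_chart_id (chart_at_dom c)).2. Qed.

(** The transformation rule recovers all coordinates from those in [c]. *)
Lemma tangent_ext (p : M) (c : chart_at p) (u v : tangent p) :
  u c = v c -> u = v.
Proof.
move=> uv; apply: val_inj; apply/funext => d.
have /asboolP/(_ c d) /= -> := coordinatesP u.
have /asboolP/(_ c d) /= -> := coordinatesP v.
by rewrite uv.
Qed.

Lemma coordinates_linear (p : M) (c : chart_at p) (a : R) (u v : tangent p) :
  (a *: u + v) c = a *: u c + v c.
Proof. exact: (congr1 (fun w => w c) (linearP \val a u v)). Qed.

Lemma tangent_of_linear (p : M) (c : chart_at p) :
  linear (tangent_of c : 'rV[R]_n -> tangent p).
Proof.
move=> a u v; apply: (@tangent_ext _ c).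
by rewrite coordinates_linear !tangent_ofE.
Qed.

End TangentCoordinates.

(* Tests only the charts that [differential] computes in; for smooth maps
   nothing is lost. *)
Definition differentiable_at (R : realType) (m n : nat)
    (M : smoothManifoldType R m) (N : smoothManifoldType R n) (F : M -> N)
    (p : M) : Prop :=
  {for p, continuous F} /\
  differentiable
    (some_chart (F p) \o F \o chart_inv (some_chart p) : 'rV[R]_m -> 'rV[R]_n)
    (some_chart p p).

(** * Chain rule for maps between manifolds *)

Section ManifoldDifferentiable.
Context {R : realType} {l m n : nat} {L : smoothManifoldType R l}
  {M : smoothManifoldType R m} {N : smoothManifoldType R n}.

Lemma smooth_differentiable_at (F : L -> M) (p : L) :
  smooth_map F -> differentiable_at F p.
Proof.
move=> [cF sF]; split; first exact: cF.
case: (some_chart p) (some_chart (F p)) => [c ac cp] [d ad dp] /=.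
by have [+ _] := sF c d ac ad 1%N; apply; exists p.
Qed.

Lemma differential_linear (F : L -> M) (p : L) :
  linear (@differential _ _ _ _ _ F p).
Proof. by move=> a u v; rewrite /differential -tangent_of_linear -linearP. Qed.

Let local_comp (F : L -> M) (G : M -> N) (p : L) :
  differentiable_at F p -> differentiable_at G (F p) ->
  let c := some_chart p in let d := some_chart (F p) in
  let e := some_chart (G (F p)) in
  let f := e \o (G \o F) \o chart_inv c : 'rV[R]_l -> 'rV[R]_n in
  differentiable f (c p) /\
  'd f (c p) = 'd (e \o G \o chart_inv d : 'rV[R]_m -> 'rV[R]_n) (d (F p)) \o
               'd (d \o F \o chart_inv c : 'rV[R]_l -> 'rV[R]_m) (c p)
    :> ('rV[R]_l -> 'rV[R]_n).
Proof.
move=> [cF dF] [_ dG] c d e f.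
pose f1 := d \o F \o chart_inv c : 'rV[R]_l -> 'rV[R]_m.
pose f2 := e \o G \o chart_inv d : 'rV[R]_m -> 'rV[R]_n.
have f1p : f1 (c p) = d (F p).
  by rewrite /f1/= chart_mapK//; exact: chart_at_dom.
have df1 : differentiable f1 (c p) by exact: dF.
have df2 : differentiable f2 (f1 (c p)) by rewrite f1p.
have near_f : \forall x \near c p, (f2 \o f1) x = f x.
  (* Continuity of [F] keeps nearby points inside the domain of [d], where [chart_inv d] cancels
     [d]. *)
  have dF' := cF _ (chart_near_dom (chart_at_dom d)).
  have := near_chart_inv (chart_at_dom c) dF'.
  by apply: filterS => x dx; rewrite /f2 /f1 /f /= chart_mapK.
have [df dfE] := near_eq_diff near_f (differentiable_comp df1 df2).
by split; [exact: df|move: (etrans dfE (diff_comp df1 df2)); rewrite f1p].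
Qed.

Lemma differentiable_at_comp (F : L -> M) (G : M -> N) (p : L) :
  differentiable_at F p -> differentiable_at G (F p) ->
  differentiable_at (G \o F) p.
Proof.
move=> dF dG; split; last exact: (local_comp dF dG).1.
exact: continuous_comp dF.1 dG.1.
Qed.

Lemma differential_comp (F : L -> M) (G : M -> N) (p : L) (u : tangent p) :
  differentiable_at F p -> differentiable_at G (F p) ->
  differential (G \o F) u = differential G (differential F u).
Proof.
move=> dF dG; rewrite /differential tangent_ofE.
by congr tangent_of; rewrite (local_comp dF dG).2.
Qed.

End ManifoldDifferentiable.

Lemma differential_id (R : realType) (n : nat) (M : smoothManifoldType R n)
  (p : M) (u : tangent p) : differential (@id M) u = u.
Proof.
apply: (@tangent_ext _ _ _ _ (some_chart p)); rewrite tangent_ofE.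
by rewrite (diff_chart_id (chart_at_dom (some_chart p))).2.
Qed.

Lemma differential_can_inj (R : realType) (m n : nat)
    (M : smoothManifoldType R m) (N : smoothManifoldType R n) (F : M -> N)
    (G : N -> M) (p : M) : cancel F G ->
  differentiable_at F p -> differentiable_at G (F p) ->
  injective (@differential _ _ _ _ _ F p).
Proof.
move=> FK dF dG u v uv.
have : differential (G \o F) u = differential (G \o F) v.
  by rewrite (differential_comp u dF dG) (differential_comp v dF dG) uv.
(* [G (F p)] and [p] are only propositionally equal, so their tangent types differ; replacing the
   whole map keeps the goal well typed. *)
have -> : G \o F = id by apply/funext => q /=; rewrite FK.
by rewrite !differential_id.
Qed.

Lemma is_diff_translation (R : realType) (W : normedModType R) (a x : W) :
  is_diff x (cst a + id) id.
Proof.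
rewrite -[X in is_diff _ _ X]add0r.
exact: (@is_diffD _ _ _ _ _ _ _ _ (is_diff_cst a x) (is_diff_id x)).
Qed.

(** * Tangent spaces and translations of the vector space *)

Section VectorTangent.
Context {R : realType} {V : vectType R}.
Local Notation VM := (vect_manifold V).

Lemma vcoord_linear : linear (vcoord : V -> 'rV[R]_(\dim {:V})).
Proof. exact: passmx.rVof_linear. Qed.

HB.instance Definition _ := GRing.isLinear.Build R V 'rV[R]_(\dim {:V}) _
  (vcoord : V -> _) vcoord_linear.

Definition vect_tangent (q : VM) (v : V) : tangent q :=
  tangent_of (vect_chart_at q) (vcoord v).

Lemma vect_tangentK (q : VM) : cancel (vect_tangent q) (@tangent_vect _ _ q).
Proof. by move=> v; rewrite /tangent_vect tangent_ofE vcoordK. Qed.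

Lemma tangent_vect_inj (q : VM) : injective (@tangent_vect R V q).
Proof.
move=> u v /(can_inj vcoord_invK); exact: tangent_ext.
Qed.

Lemma vect_tangent_linear (q : VM) : linear (vect_tangent q).
Proof.
by move=> a u v; rewrite /vect_tangent vcoord_linear; exact: tangent_of_linear.
Qed.

(** The atlas is a singleton. This reconciles [tangent_vect], which reads the global chart, with
    [differential], which uses chosen charts. *)
Lemma vect_chart_at_unique (q : VM) : vect_chart_at q = some_chart q.
Proof.
case: (some_chart q) => c ac cq; have cE : c = vect_chart := ac.
by subst c; congr ChartAt; exact: Prop_irrelevance.
Qed.

Definition vect_shift (a : V) (v : VM) : VM := a + (v : V).

Lemma vect_some_chart (q : VM) : some_chart q = vect_chart :> chart _ _ _.
Proof. by case: (some_chart q). Qed.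

Lemma vect_shift_rep (a : V) (q r : VM) :
  some_chart r \o vect_shift a \o chart_inv (some_chart q) =
  cst (vcoord a) + id :> ('rV[R]_(\dim {:V}) -> _).
Proof.
rewrite !vect_some_chart; apply/funext => x /=.
by rewrite /vect_shift raddfD /= vcoord_invK.
Qed.

Lemma vect_shift_differentiable_at (a : V) (q : VM) :
  differentiable_at (vect_shift a) q.
Proof.
split; last by rewrite vect_shift_rep;
  exact: (ex_diff (is_diff_def := is_diff_translation _ _)).
(* The topology of [VM] is induced by [vcoord], so continuity is checked on row vectors. *)
have -> : vect_shift a = vcoord_inv \o (cst (vcoord a) + id) \o vcoord.
  apply/funext => x; rewrite -[LHS]vcoordK /=; congr vcoord_inv.
  by rewrite /vect_shift raddfD.
apply: continuous_comp; first exact: vcoord_continuous.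
apply: continuous_comp; last exact: vcoord_inv_continuous.
by apply: differentiable_continuous;
  exact: (ex_diff (is_diff_def := is_diff_translation _ _)).
Qed.

Lemma tangent_vect_shift (a : V) (q : VM) (u : tangent q) :
  tangent_vect (differential (vect_shift a) u) = tangent_vect u.
Proof.
rewrite /tangent_vect; congr vcoord_inv.
rewrite !vect_chart_at_unique tangent_ofE vect_shift_rep.
by rewrite (diff_val (is_diff_def := is_diff_translation _ _)).
Qed.

End VectorTangent.

(** * The differential of the logarithm and its inverse *)

Section LogEuclidean.
Context {R : realType} {V : vectType R} {n : nat} {M : smoothManifoldType R n}
  (phi : diffeomorphism M (vect_manifold V)).

Let dphi p : differentiable_at phi p.
Proof. exact: smooth_differentiable_at (diffeo_smooth phi). Qed.

Let dphi_inv q : differentiable_at (diffeo_inv phi) q.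
Proof. exact: smooth_differentiable_at (diffeo_inv_smooth phi). Qed.

(** Differentiate [phi \o F = vect_shift a \o phi]: the shift has identity differential. Leaving [F]
    abstract covers left and right translations at once. *)
Lemma vect_differential_translation (a : V) (F : M -> M) (p : M)
    (x : tangent p) : (forall q, phi (F q) = vect_shift a (phi q)) ->
  vect_differential phi (differential F x) = vect_differential phi x.
Proof.
move=> phiF.
have FE : F = diffeo_inv phi \o (vect_shift a \o phi).
  by apply/funext => q; rewrite /= -phiF diffeoK.
have dsphi : differentiable_at (vect_shift a \o phi) p.
  exact: differentiable_at_comp (vect_shift_differentiable_at _ _).
have dF : differentiable_at F p by rewrite FE; exact: differentiable_at_comp.
rewrite /vect_differential -(differential_comp x dF (dphi _)).
(* Once folded, the value lies in [V] whatever the base point, so the map can be replaced. *)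
rewrite -/(vect_differential (phi \o F) x).
have -> : phi \o F = vect_shift a \o phi by apply/funext.
rewrite /vect_differential.
rewrite (differential_comp x (dphi p) (vect_shift_differentiable_at a (phi p))).
exact: tangent_vect_shift.
Qed.

Lemma vect_differential_inj (p : M) :
  injective (@vect_differential _ _ _ _ phi p).
Proof.
by move=> u v /tangent_vect_inj; apply: differential_can_inj;
  first exact: diffeoK.
Qed.

Definition diff_inv (q : V) (v : V) : tangent (diffeo_inv phi q) :=
  differential (diffeo_inv phi) (vect_tangent (q : vect_manifold V) v).

Lemma diff_invK (q : V) :
  cancel (diff_inv q) (@vect_differential _ _ _ _ phi _).
Proof.
move=> v; rewrite /vect_differential /diff_inv.
rewrite -(differential_comp _ (dphi_inv _) (dphi _)).
rewrite -/(vect_differential (phi \o diffeo_inv phi) _).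
have -> : phi \o diffeo_inv phi = id.
  by apply/funext => r /=; rewrite diffeo_invK.
by rewrite /vect_differential differential_id vect_tangentK.
Qed.

(** A right inverse of an injective map is also a left inverse. *)
Lemma vect_differentialK (q : V) :
  cancel (@vect_differential _ _ _ _ phi _) (diff_inv q).
Proof. by move=> x; apply: vect_differential_inj; rewrite diff_invK. Qed.

Lemma diff_inv_linear (q : V) : linear (diff_inv q).
Proof.
by move=> a u v; rewrite /diff_inv vect_tangent_linear differential_linear.
Qed.

HB.instance Definition _ (q : V) := GRing.isLinear.Build R V
  (tangent (diffeo_inv phi q)) _ (diff_inv q) (diff_inv_linear q).

End LogEuclidean.

Theorem proposition2p16 (R : realType) (V : vectType R) (n : nat)
    (M : smoothManifoldType R n) (phi : diffeomorphism M (vect_manifold V))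
    (g : riemannian_metric M) :
  bi_invariant (log_euclidean_mul phi) g <->
  exists ip : {dot V for idfun}, forall (p : M) (x y : tangent p),
    g p x y = ip (vect_differential phi x) (vect_differential phi y).
Proof.
have left_translation (u q : M) :
    phi (log_euclidean_mul phi u q) = vect_shift (phi u) (phi q).
  by rewrite /log_euclidean_mul diffeo_invK.
have right_translation (u q : M) :
    phi (log_euclidean_mul phi q u) = vect_shift (phi u) (phi q).
  by rewrite left_translation /vect_shift addrC.
split=> [[g_left _]|[ip gE]]; last first.
  split=> u p x y; rewrite !gE.
    by rewrite !(vect_differential_translation _ (left_translation u)).
  by rewrite !(vect_differential_translation _ (right_translation u)).
(* A variable [q] with an equation is needed: the translated point equals the identity only
   propositionally, and [subst] then aligns the tangent types. *)
have at_origin q (X Y : tangent q) : q = diffeo_inv phi 0 ->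
    g q X Y = g (diffeo_inv phi 0) (diff_inv phi 0 (vect_differential phi X))
                (diff_inv phi 0 (vect_differential phi Y)).
  by move=> qE; subst q; rewrite !vect_differentialK.
(* The inner product is the metric at the identity, carried to [V] by [diff_inv phi 0], which is
   injective since it has a left inverse. *)
have [ip ipE] := pullback_dot_ex (g (diffeo_inv phi 0))
  (can_inj (diff_invK phi (0 : V))).
exists ip => p x y; rewrite ipE.
(* [u] is the group inverse of [p], so left translation by [u] moves [p] to the identity. *)
pose u := diffeo_inv phi (- (phi p : V)).
rewrite -(g_left u p).
rewrite -(vect_differential_translation x (left_translation u)).
rewrite -(vect_differential_translation y (left_translation u)).
apply: at_origin.
by rewrite /log_euclidean_mul diffeo_invK addNr.
Qed.
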